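(* Let $\mathcal{I}$ be either $\mathcal{N}$ or $\mathcal{M}$. Suppose that $\mathcal{F}$ and $\tilde{\mathcal{F}}$ are classes of $\mathcal{B}_{\mathcal{I}}$-measurable functions $\mathbb{R}\to\mathbb{R}$ such that every trigonometric polynomial belongs to $\mathcal{F}$, $\mathcal{F}\subset\tilde{\mathcal{F}}$, and $\tilde{\mathcal{F}}$ is a translation invariant linear subspace of the space of $\mathcal{B}_{\mathcal{I}}$-measurable functions with the property that whenever $f\in\tilde{\mathcal{F}}$ and $f=0$ $\mathcal{I}$-almost everywhere, then $f=0$ everywhere. Then $\mathrm{sc}(\mathcal{F})=\omega_1$.
   Context: $\mathcal{N}$ is the $\sigma$-ideal of Lebesgue nullsets of $\mathbb{R}$ and $\mathcal{M}$ is the $\sigma$-ideal of first category (meager) subsets of $\mathbb{R}$. For $\mathcal{I}\in\{\mathcal{N},\mathcal{M}\}$, $\mathcal{B}_{\mathcal{I}}$ is the $\sigma$-algebra generated by the Borel sets and $\mathcal{I}$ (so $\mathcal{B}_{\mathcal{I}}$-measurable means Lebesgue measurable, respectively having the Baire property). A property holds $\mathcal{I}$-almost everywhere if the set of points where it fails is in $\mathcal{I}$. A trigonometric polynomial is a function of the form $a_0+\sum_{k=1}^m (a_k\cos 2\pi kx+b_k\sin 2\pi kx)$ with real coefficients. A class $\tilde{\mathcal F}$ is translation invariant if $f\in\tilde{\mathcal F}$ and $b\in\mathbb{R}$ imply that $x\mapsto f(x+b)$ is in $\tilde{\mathcal F}$. $\mathbb{R}^{\mathbb{R}}$ is the set of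 all functions $f:\mathbb{R}\to\mathbb{R}$. A difference operator is a map $D:\mathbb{R}^{\mathbb{R}}\to\mathbb{R}^{\mathbb{R}}$ of the form $(Df)(x)=\sum_{i=1}^n a_i f(x+b_i)$ with $a_i,b_i\in\mathbb{R}$; $\mathcal{D}$ is the set of difference operators. A system of difference equations is a set $S\subset\mathcal{D}\times\mathbb{R}^{\mathbb{R}}$; a function $f:\mathbb{R}\to\mathbb{R}$ is a solution to $S$ if $Df=g$ for every $(D,g)\in S$. A subsystem of $S$ is a subset of $S$. For $\mathcal{F}\subset\mathbb{R}^{\mathbb{R}}$ the solvability cardinal $\mathrm{sc}(\mathcal{F})$ is the minimal cardinal $\kappa$ with the following property: for every system $S$ of difference equations, if every subsystem of $S$ of cardinality less than $\kappa$ has a solution in $\mathcal{F}$, then $S$ has a solution in $\mathcal{F}$. *)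

(* Defs.v *)
From mathcomp Require Import all_boot all_order all_algebra.
From mathcomp Require Import all_classical all_reals all_analysis.

Set Implicit Arguments.
Unset Strict Implicit.
Unset Printing Implicit Defensive.

Import Order.TTheory GRing.Theory Num.Theory.
Import numFieldNormedType.Exports.

Local Open Scope classical_set_scope.
Local Open Scope card_scope.
Local Open Scope ring_scope.

(** A cardinal is represented by any set of that cardinality, in any type: a
    predicate on sets stands for the cardinal, and the uniqueness lemmas below
    show that each such predicate determines its set up to equipotence. *)

Definition card_lt (T U : Type) (A : set T) (B : set U) : Prop :=
  A #<= B /\ ~ (B #<= A).

Definition is_omega1 (T : Type) (K : set T) : Prop :=
  ~ countable K /\
  forall (U : Type) (L : set U), ~ countable L -> K #<= L.

Lemma is_omega1_unique (T U : Type) (K : set T) (L : set U) :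
  is_omega1 K -> is_omega1 L -> K #= L.
Proof.
by move=> [Ku Kmin] [Lu Lmin]; rewrite card_eq_le Kmin//= Lmin.
Qed.

Section ideals.
Context (R : realType).

Definition nullsets : set (set R) :=
  [set A | (@lebesgue_measure R).-negligible A].

Definition nowhere_dense (A : set R) : Prop := interior (closure A) = set0.

Definition meager : set (set R) :=
  [set A | exists2 N : nat -> set R,
             (forall n, nowhere_dense (N n)) & A = \bigcup_n N n].

Definition ae_for (I : set (set R)) (P : R -> Prop) : Prop := I [set x | ~ P x].

(** The library's [measurable] sets of [R] are the Borel sets. *)
Definition borel_mod (I : set (set R)) : set (set R) :=
  <<s (measurable : set (set R)) `|` I >>.

Definition borel_mod_measurable (I : set (set R)) (f : R -> R) : Prop :=
  forall Y : set R, measurable Y -> borel_mod I (f @^-1` Y).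

End ideals.

Section function_classes.
Context (R : realType).

Definition trigonometric_polynomial (f : R -> R) : Prop :=
  exists (m : nat) (a b : nat -> R), forall x : R,
    f x = a 0%N + \sum_(1 <= k < m.+1)
            (a k * cos (2 * pi * k%:R * x) + b k * sin (2 * pi * k%:R * x)).

Definition translation_invariant (F : set (R -> R)) : Prop :=
  forall (f : R -> R) (b : R), F f -> F (fun x => f (x + b)).

Definition linear_subspace (F : set (R -> R)) : Prop :=
  F (fun=> 0) /\
  forall (c : R) (f g : R -> R), F f -> F g -> F (fun x => c * f x + g x).

End function_classes.

Section difference_equations.
Context (R : realType).

Definition difference_operator (D : (R -> R) -> (R -> R)) : Prop :=
  exists (n : nat) (a b : 'I_n -> R), forall (f : R -> R) (x : R),
    D f x = \sum_(i < n) a i * f (x + b i).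

Definition difference_system
    (S : set (((R -> R) -> (R -> R)) * (R -> R))) : Prop :=
  forall D g, S (D, g) -> difference_operator D.

Definition solution
    (S : set (((R -> R) -> (R -> R)) * (R -> R))) (f : R -> R) : Prop :=
  forall D g, S (D, g) -> D f = g.

Definition solvable_in (F : set (R -> R))
    (S : set (((R -> R) -> (R -> R)) * (R -> R))) : Prop :=
  exists2 f : R -> R, F f & solution S f.

Definition solvability_property (F : set (R -> R)) (T : Type) (K : set T)
    : Prop :=
  forall S, difference_system S ->
    (forall S', S' `<=` S -> card_lt S' K -> solvable_in F S') ->
    solvable_in F S.

(** Cardinals being totally ordered, minimal is stated as least. *)
Definition is_solvability_cardinal (F : set (R -> R)) (T : Type) (K : set T)
    : Prop :=
  solvability_property F K /\
  forall (U : Type) (L : set U), solvability_property F L -> K #<= L.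

Lemma is_solvability_cardinal_unique (F : set (R -> R)) (T U : Type)
    (K : set T) (L : set U) :
  is_solvability_cardinal F K -> is_solvability_cardinal F L -> K #= L.
Proof.
by move=> [KP Kmin] [LP Lmin]; rewrite card_eq_le Kmin//= Lmin.
Qed.

End difference_equations.

(* Main.v *)
Require Import Defs.
From mathcomp Require Import all_boot all_order all_algebra.
From mathcomp Require Import all_classical all_reals all_analysis.
From mathcomp Require Import wochoice measurable_realfun ring lra.

Set Implicit Arguments.
Unset Strict Implicit.
Unset Printing Implicit Defensive.

Import Order.TTheory GRing.Theory Num.Theory.
Import numFieldNormedType.Exports.

Local Open Scope classical_set_scope.
Local Open Scope card_scope.
Local Open Scope ring_scope.

(** Both bounds on the solvability cardinal rest on one fact, shared by the
    null sets and the meager sets ([steinhaus_ideal]): a set [A] that is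
    measurable modulo the ideal and does not belong to it contains, for every
    [n] and all sufficiently small [s_0, ..., s_(n-1)], some configuration
    [x + s_0, ..., x + s_(n-1)].  Such an [A] fills an interval up to a part
    that is small (by the Lebesgue density theorem), respectively meager (by the
    Baire property), and [n] translates of that part do not cover half of the
    interval.

    Upper bound ([omega1_solvability]).  A difference operator is a finite list
    of pairs of reals (coefficient, shift), and such lists form a separable
    space.  So a system [S] has a countable subsystem [C] whose operators are
    dense among those of [S].  Let [f] solve [C], let [(D, g)] be in [S], and
    let [f'] solve [C] together with [(D, g)].  Then [f' - f] is in [Ft] and is
    annihilated by all the operators of [C].  The operators annihilating a given
    member of [Ft] form a closed set ([diffop_kernel_closed]): a measurable
    function is nearly constant on a set outside the ideal, so by the Steinhaus
    property a small change of the shifts can be made invisible at some point;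
    and a member of [Ft] vanishing almost everywhere vanishes.  Hence
    [D f = D f' = g], and [f] solves all of [S].

    Lower bound ([solvability_property_uncountable]).  Let [f_n] be the sum over
    [k < n] of [8 ^ k * cos (2 pi 4 ^ k x)].  The equations
    [f (x + 4 ^ -n) - f x = f_n (x + 4 ^ -n) - f_n x] are satisfied by [f_m] for
    all [n <= m], because the later terms have period [4 ^ -n]; so every finite
    subsystem is solved by a trigonometric polynomial.  A measurable solution
    [f] of all of them would be bounded on a set outside the ideal, and the
    Steinhaus property would give four points [x], [x + t], [x + 2 t], [x + 3 t]
    of it with [t = 4 ^ -(m + 1)] and [m] large.  Along these points [f] varies
    exactly as [f_(m+1)] does, whose last term takes there the values
    [8 ^ m] times [cos], [- sin], [- cos], [sin] of one angle, and dominates all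
    the previous terms; so [f] varies by an amount of the order of [8 ^ m].

    The cardinal itself is realised as a set of reals: a minimal uncountable
    initial segment of a well-ordering of [R] ([exists_omega1]). *)

(** * The first uncountable cardinal *)

Lemma well_order_total (T : eqType) (r : rel T) : well_order r -> total r.
Proof.
move=> wo x y; have wop : wo_chain r predT by exact: withinW.
exact: (wo_chainW wop).
Qed.

Lemma well_order_wf (T : eqType) (r : rel T) : well_order r ->
  well_founded (fun x y => r x y && (x != y)).
Proof.
move=> wo x; apply: contrapT => nAx.
have [|z [[/asboolP nAz lb] _]] := wo
  [pred t : T | `[< ~ Acc (fun x y => r x y && (x != y)) t >]].
  by exists x; apply/asboolP.
apply: nAz; constructor=> y /andP[ryz yz]; apply: contrapT => nAy.
have wop : wo_chain r predT by exact: withinW.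
move/eqP: yz; apply; apply: (wo_chain_antisymmetric wop) => //.
by rewrite ryz lb//; exact/asboolP.
Qed.

(** Transfinite recursion: each [x] is sent to an element of [L] not used below
    [x], which exists because only countably many have been used. *)
Lemma countable_segments_le (T U : Type) (lt : T -> T -> Prop) (K : set T)
    (L : set U) :
  well_founded lt ->
  (forall x y, K x -> K y -> x <> y -> lt x y \/ lt y x) ->
  (forall x, K x -> countable [set y | lt y x]) ->
  ~ countable L -> K #<= L.
Proof.
move=> wf tot seg Lunc.
have [u0 Lu0] : L !=set0.
  by apply/set0P/negP => /eqP L0; apply: Lunc; rewrite L0; exact: countable0.
pose step (x : T) (rec : forall y, lt y x -> U) : U :=
  if pselect (exists u, L u /\ forall y (p : lt y x), rec y p <> u) is left e
  then projT1 (cid e) else u0.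
pose h := Fix wf (fun=> U) step.
have hE x : h x = step x (fun y _ => h y).
  rewrite /h Fix_eq// => {}x f g fg; congr step.
  by apply/functional_extensionality_dep => y; apply/funext => p.
have hP x : K x -> L (h x) /\ forall y, lt y x -> h y <> h x.
  move=> Kx; rewrite [h x]hE /step; case: pselect => [e|ne].
    by case: (cid e) => u [].
  exfalso; apply: Lunc; apply: sub_countable (seg _ Kx).
  apply: card_le_trans (card_image_le h _); apply: subset_card_le => u Lu.
  apply: contrapT => nu; apply: ne; exists u; split=> // y p hy.
  by apply: nu; exists y.
have hfun : set_fun K L h by move=> x Kx; have [] := hP _ Kx.
have hinj : set_inj K h.
  move=> x y /set_mem Kx /set_mem Ky hxy; apply: contrapT => xy.
  by have [/(hP _ Ky).2|/(hP _ Kx).2/(_ (esym hxy))] := tot _ _ Kx Ky xy.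
rewrite -(card_le_eql (inj_card_eq hinj)); apply: subset_card_le.
by move=> _ [x Kx <-]; exact: hfun.
Qed.

(** The least initial segment of a well-ordering that is uncountable, or [T]
    itself if all its proper initial segments are countable. *)
Lemma exists_omega1 (T : choiceType) :
  ~ countable [set: T] -> exists K : set T, is_omega1 K.
Proof.
move=> Tunc; have [r wo] := well_ordering_principle T.
have tot := well_order_total wo; have wf := well_order_wf wo.
set lt := (fun x y => _) in wf.
suff [K [Kunc Kseg]] : exists K : set T, ~ countable K /\
    forall x, K x -> countable [set y | lt y x].
  exists K; split=> // U L; apply: (countable_segments_le wf) => // x y _ _.
  move=> /eqP xy; rewrite /lt xy [y == x]eq_sym xy !andbT.
  exact/orP/tot.
have [|nex] := pselect (exists x, ~ countable [set y | lt y x]); last first.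
  exists setT; split=> // x _; apply: contrapT => nx.
  by apply: nex; exists x.
move=> [x Kx]; elim/(well_founded_ind wf): x Kx => x IH Kx.
have [|nex] := pselect (exists2 y, lt y x & ~ countable [set z | lt z y]).
  by move=> [y yx]; exact: IH.
exists [set y | lt y x]; split=> // y yx; apply: contrapT => ny.
by apply: nex; exists y.
Qed.

(** * Sets measurable modulo a sigma-ideal *)

Record sigma_ideal (T : Type) (I : set (set T)) : Prop := SigmaIdeal {
  sigma_idealS : forall A B, A `<=` B -> I B -> I A;
  sigma_ideal0 : I set0;
  sigma_ideal_bigcup : forall A : nat -> set T,
    (forall n, I (A n)) -> I (\bigcup_n A n) }.

Section sigma_ideals.
Context (T : Type) (I : set (set T)) (sI : sigma_ideal I).

Lemma sigma_idealU (A B : set T) : I A -> I B -> I (A `|` B).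
Proof.
move=> IA IB; rewrite -bigcup2E; apply: (sigma_ideal_bigcup sI).
by case=> [|[|n]] //=; exact: (sigma_ideal0 sI).
Qed.

Lemma sigma_ideal_countable (X : countType) (A : X -> set T) :
  (forall x, I (A x)) -> I (\bigcup_x A x).
Proof.
move=> IA; pose B n := if unpickle n is Some x then A x else set0.
apply: (@sigma_idealS _ _ sI _ (\bigcup_n B n)) => [t [x _ Axt]|].
  by exists (pickle x) => //; rewrite /B pickleK.
apply: (sigma_ideal_bigcup sI) => n; rewrite /B.
by case: unpickle => [x|]; [exact: IA|exact: (sigma_ideal0 sI)].
Qed.

Lemma sigma_ideal_nonempty (A : set T) : ~ I A -> A !=set0.
Proof.
move=> nIA; apply/set0P/eqP => A0; apply: nIA.
by rewrite A0; exact: (sigma_ideal0 sI).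
Qed.

(** For [C] the Borel sets and [I] the null sets this is Lebesgue measurability;
    for [C] the open sets and [I] the meager sets it is the Baire property. *)
Definition approximable (C : set (set T)) : set (set T) :=
  [set A | exists2 B, C B & I (A `\` B) /\ I (B `\` A)].

(** Complements need only stay in [C] modulo [I], so that the lemma applies to
    the open sets, which are not closed under complement. *)
Lemma generated_approximable (C G : set (set T)) :
  C set0 ->
  (forall F : nat -> set T, (forall n, C (F n)) -> C (\bigcup_n F n)) ->
  (forall A, C A -> approximable C (~` A)) ->
  G `<=` approximable C -> <<s G >> `<=` approximable C.
Proof.
move=> C0 CU CC GC; apply: smallest_sub => //; split.
- by exists set0 => //; rewrite setD0; split; exact: (sigma_ideal0 sI).
- move=> A [B CB [IAB IBA]]; rewrite setTD.
  have [D CD [I1 I2]] := CC _ CB; exists D => //; split.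
    apply: (sigma_idealS sI) (sigma_idealU I1 IBA) => x [nAx nDx].
    by have [Bx|nBx] := pselect (B x); [right|left].
  apply: (sigma_idealS sI) (sigma_idealU I2 IAB) => x [Dx /contrapT Ax].
  by have [Bx|nBx] := pselect (B x); [left; split=> // nB; exact: nB|right].
- move=> F FC.
  have {FC} /choice[E FE] n : exists B, [/\ C B, I (F n `\` B) & I (B `\` F n)].
    by have [B CB [? ?]] := FC n; exists B.
  exists (\bigcup_n E n); first by apply: CU => n; have [] := FE n.
  split.
    apply: (sigma_idealS sI) (sigma_ideal_bigcup sI _); last first.
      by move=> n; have [_ h _] := FE n; exact: h.
    move=> x [[n _ Fnx] nE]; exists n => //; split=> // Enx.
    by apply: nE; exists n.
  apply: (sigma_idealS sI) (sigma_ideal_bigcup sI _); last first.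
    by move=> n; have [_ _ h] := FE n; exact: h.
  move=> x [[n _ Fnx] nE]; exists n => //; split=> // Enx.
  by apply: nE; exists n.
Qed.

End sigma_ideals.

(** * Steinhaus's theorem for measure *)

Section steinhaus.
Context {R : realType}.
Local Notation mu := (@lebesgue_measure R).

(** A form of Steinhaus's theorem on difference sets for finite configurations:
    for a given [A], the size [d] depends only on the number of points. *)
Definition steinhaus (A : set R) : Prop :=
  forall n : nat, exists2 d : R, 0 < d &
    forall s : nat -> R, (forall i, (i < n)%N -> `|s i| < d) ->
    exists x, forall i, (i < n)%N -> A (x + s i).

(** It is enough that the part of some ball missed by [A] cannot cover the
    concentric half ball by [n] translates: a point left uncovered has all its
    small translates in the ball, hence in [A]. *)
Lemma steinhaus_ball (A : set R) :
  (forall n : nat, exists (c r : R), 0 < r /\ forall s : nat -> R,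
    ~ ball c (r / 2) `<=` \bigcup_(i < n) [set x | (ball c r `\` A) (x + s i)]) ->
  steinhaus A.
Proof.
move=> + n => /(_ n)[c [r [r0 nsub]]]; exists (r / 2); first by rewrite divr_gt0.
move=> s ss; have /existsNP[x /not_implyP[cx ncov]] := nsub s.
exists x => i iltn; apply: contrapT => nA; apply: ncov.
exists i => //=; split=> //.
move: cx; rewrite /ball/= => cx; rewrite opprD addrA.
by rewrite (le_lt_trans (ler_normB _ _))// [ltRHS]splitr ltrD// ss.
Qed.

Lemma nullsets_sigma_ideal : sigma_ideal (@nullsets R).
Proof.
split.
- by move=> A B AB; exact: negligibleS.
- exact: negligible_set0.
- by move=> A nA; exact: negligible_bigcup.
Qed.

Lemma measurable_shift (A : set R) (s : R) :
  measurable A -> measurable [set x | A (x + s)].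
Proof.
move=> mA; rewrite -[X in measurable X]setTI.
by apply: (measurable_funD (@measurable_id _ _ setT)
  (@measurable_cst _ _ _ _ setT s)).
Qed.

Lemma lebesgue_measure_shift (A : set R) (s : R) :
  measurable A -> mu [set x | A (x + s)] = mu A.
Proof.
move=> mA.
pose sh (x : measurableTypeR R) : measurableTypeR R := x + s.
have ms : measurable_fun setT sh.
  by move=> _ B mB; rewrite setTI; exact: measurable_shift.
rewrite -[LHS]/(pushforward mu sh A).
apply/esym/lebesgue_measure_unique => //= _ [[a b]] _ <-; rewrite /pushforward.
rewrite (_ : _ @^-1` _ = `]a - s, b - s]%classic); last first.
  by apply/seteqP; split=> x /=; rewrite !in_itv/= ltrBlDr lerBrDr.
by rewrite !lebesgue_measure_itv/= !lte_fin ltrD2r -!EFinD opprB addrA subrK.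
Qed.

(** A consequence of the Lebesgue density theorem: [B] has a density point
    inside [B]. *)
Lemma density_interval (B : set R) (e : R) : measurable B -> ~ nullsets B ->
  0 < e -> exists c r : R, 0 < r /\ (mu (ball c r `\` B) < (e * r)%:E)%E.
Proof.
move=> mB nB e0.
have [c [Bc]] : exists c, B c /\
    (mu (B `&` ball c r) * (mu (ball c r))^-1)%E @[r --> 0^'+] --> 1%:E.
  have [N [mN N0 hN]] := lebesgue_density mB.
  apply: contrapT => nex; apply: nB; exists N; split=> // x Bx; apply: hN => /= cx.
  by apply: nex; exists x; split=> //; move: cx; rewrite indicE mem_set.
move=> /fine_cvgP[_ cv].
have e2 : 1 - e / 2 < 1 :> R by rewrite ltrBlDr ltrDl divr_gt0.
near (0 : R)^'+ => r.
have r0 : 0 < r by near: r; exact: nbhs_right_gt.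
have : 1 - e / 2 < fine (mu (B `&` ball c r) * (mu (ball c r))^-1)%E.
  by near: r; exact: (cvgr_gt _ cv).
have mb : measurable (ball c r) by exact: measurable_ball.
have mub : mu (ball c r) = (r *+ 2)%:E by rewrite lebesgue_measure_ball// ltW.
have fB : mu (B `&` ball c r) \is a fin_num.
  rewrite ge0_fin_numE//; apply: le_lt_trans (_ : _ <= mu (ball c r))%E _.
    by apply: le_measure; rewrite ?inE//; exact: measurableI.
  by rewrite mub ltry.
move=> H; exists c, r; split=> //; rewrite measureD//=; last by rewrite mub ltry.
have r2 : 0 < r *+ 2 by rewrite mulrn_wgt0.
move: H; rewrite mub -(fineK fB) inver gt_eqF// -EFinM/= ltr_pdivlMr// => H.
by rewrite setIC -(fineK fB) lte_fin; lra.
Unshelve. all: by end_near. Qed.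

(** Modulo a null set [A] is Borel; around a density point it misses less than
    [1 / n.+1] of the radius of a ball, so [n] translates of the missed part are
    too small to cover the half ball. *)
Lemma steinhaus_nullsets (A : set R) :
  borel_mod (@nullsets R) A -> ~ nullsets A -> steinhaus A.
Proof.
have sI := nullsets_sigma_ideal => bA nA.
have [B mB [AB [N [mN N0 BAN]]]] : approximable (@nullsets R) measurable A.
  move: A bA {nA}; apply: (generated_approximable sI) => //.
  - by move=> F mF; exact: bigcup_measurable.
  - by move=> B mB; exists (~` B); [exact: measurableC|
      rewrite setDv; split; exact: (sigma_ideal0 sI)].
  - move=> B [mB|nB].
      by exists B => //; rewrite setDv; split; exact: (sigma_ideal0 sI).
    exists set0; rewrite ?setD0 ?set0D//; split=> //; exact: (sigma_ideal0 sI).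
have nB : ~ nullsets B.
  move=> nB; apply: nA; apply: (sigma_idealS sI) (sigma_idealU sI nB AB) => x Ax.
  by have [|] := pselect (B x); [left|right].
apply: steinhaus_ball => n.
(* The half ball has measure [r], the [n] translates less than [n * e * r]. *)
pose e : R := n.+1%:R^-1.
have e0 : 0 < e by rewrite invr_gt0.
have [c [r [r0 small]]] := density_interval mB nB e0.
exists c, r; split=> // s cov.
pose W := (ball c r `\` B) `|` N.
have mW : measurable W.
  by apply: measurableU => //; apply: measurableD => //; exact: measurable_ball.
have muW : (mu W <= (e * r)%:E)%E.
  apply: (le_trans (measureU2 _ _ _)) => //.
    by apply: measurableD => //; exact: measurable_ball.
  by rewrite [X in (_ + X)%E]N0 adde0 ltW.
have : (mu (ball c (r / 2)) <= \sum_(i < n) mu [set x | W (x + s i)%R])%E.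
  apply: (@content_subadditive _ _ _ mu (ball c (r / 2))
    (fun i => [set x | W (x + s i)%R]) n).
  - by move=> i _; exact: measurable_shift.
  - exact: measurable_ball.
  - move=> x /cov[i /= iltn [cx nAx]].
    rewrite -(bigcup_mkord n (fun i => [set x | W (x + s i)])).
    exists i => //=.
    by have [Bx|nBx] := pselect (B (x + s i)); [right; exact: BAN|left].
apply/negP; rewrite -ltNge lebesgue_measure_ball; last by rewrite divr_ge0// ltW.
apply: (@le_lt_trans _ _ (\sum_(i < n) (e * r)%:E)%E).
  by apply: lee_sum => i _; rewrite lebesgue_measure_shift.
rewrite sumEFin lte_fin big_const_ord iter_addr_0 -[e * r *+ n]mulr_natr.
have -> : r / 2 *+ 2 = e * r * n.+1%:R.
  have : n.+1%:R != 0 :> R by rewrite pnatr_eq0.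
  by rewrite /e mulr2n; move: (n.+1%:R : R) => k k0; field.
by rewrite ltr_pM2l ?mulr_gt0// ltr_nat.
Qed.

End steinhaus.

(** * Steinhaus's theorem for category *)

Section category.
Context {R : realType}.

Lemma meager_sigma_ideal : sigma_ideal (@meager R).
Proof.
have nd0 : @nowhere_dense R set0 by rewrite /nowhere_dense closure0 interior0.
have ndS (A B : set R) : A `<=` B -> nowhere_dense B -> nowhere_dense A.
  rewrite /nowhere_dense -!subset0 => AB; apply: subset_trans.
  exact/interiorS/closureS.
split.
- move=> A B AB [N Nnd BN]; exists (fun n => N n `&` A) => [n|].
    by apply: ndS (Nnd n) => x [].
  by rewrite -setI_bigcupl -BN setIidr.
- by exists (fun=> set0) => //; rewrite bigcup0.
- move=> A mA.
  have {mA} /choice[N NA] n : exists N : nat -> set R,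
      (forall k, nowhere_dense (N k)) /\ A n = \bigcup_k N k.
    by have [N ? ?] := mA n; exists N.
  exists (fun k => if unpickle k is Some p then N p.1 p.2 else set0).
    by move=> k; case: unpickle => [p|//]; exact: (NA _).1.
  apply/seteqP; split=> [x [n _]|x [k _]].
    by rewrite (NA n).2 => -[k _ Nx]; exists (pickle (n, k)) => //; rewrite pickleK.
  case: unpickle => [[n j]|//] /= Nx; exists n => //.
  by rewrite (NA n).2; exists j.
Qed.

Lemma nowhere_dense_frontier (C : set R) : closed C -> nowhere_dense (C `\` C^°).
Proof.
move=> cC; rewrite /nowhere_dense -subset0.
have cD : closed (C `\` C^°).
  by apply: closedI => //; apply: open_closedC; exact: open_interior.
rewrite -((closure_id _).1 cD) interiorI => x [Cx /interior_subset]; exact.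
Qed.

Lemma nowhere_dense_meager (A : set R) : nowhere_dense A -> meager A.
Proof. by move=> nA; exists (fun=> A) => //; rewrite bigcup_const. Qed.

Lemma continuous_shift (s : R) : continuous (fun x : R => x + s).
Proof. by move=> x; apply: cvgD; [exact: cvg_id|exact: cvg_cst]. Qed.

Lemma nowhere_dense_shift (A : set R) (s : R) :
  nowhere_dense A -> nowhere_dense [set x | A (x + s)].
Proof.
rewrite /nowhere_dense -!subset0 => nA x ix; apply: (nA (x + s)).
pose V := (fun y : R => y - s) @^-1` (closure [set x | A (x + s)])^°.
have oV : open V.
  by apply: open_comp; [move=> *; exact: continuous_shift|exact: open_interior].
suff VA : V `<=` closure A.
  by move: VA; rewrite open_subsetE//; apply; rewrite /V/= addrK.
move=> y /interior_subset; rewrite closureEbigcap.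
move=> /(_ ((fun x => x + s) @^-1` closure A))/=; rewrite subrK; apply; split.
  by apply: closed_comp; [move=> *; exact: continuous_shift|exact: closed_closure].
by move=> z /= Az; exact: subset_closure.
Qed.

Lemma meager_shift (A : set R) (s : R) : meager A -> meager [set x | A (x + s)].
Proof.
move=> [N Nnd ->]; exists (fun n => [set x | N n (x + s)]) => // n.
exact: nowhere_dense_shift.
Qed.

Lemma meager_no_ball (A : set R) (c r : R) : meager A -> 0 < r -> ~ ball c r `<=` A.
Proof.
move=> [N Nnd ->] r0 cov.
have oN i : open (~` closure (N i)) by apply: closed_openC; exact: closed_closure.
have dN : dense (\bigcap_i ~` closure (N i)).
  apply: (@Baire R R) => i; split=> // O [x Ox] oO; apply: contrapT => nO.
  have : (closure (N i))^° x.
    move: x Ox; rewrite -/(O `<=` _) -open_subsetE// => x Ox.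
    by apply: contrapT => nx; apply: nO; exists x.
  by rewrite (Nnd i).
have [x [cx nN]] : ball c r `&` \bigcap_i ~` closure (N i) !=set0.
  by apply: dN; [exists c; exact: ballxx|exact: ball_open].
by have [n _ Nx] := cov _ cx; apply: (nN n) => //; exact: subset_closure.
Qed.

Lemma borel_baire_property : measurable `<=` approximable (@meager R) open.
Proof.
have sI := meager_sigma_ideal.
have -> : (measurable : set (set R)) = <<s @RGenOpens.G R >>.
  exact: RGenOpens.measurableE.
have I0 : @meager R set0 by exact: (sigma_ideal0 sI).
apply: (generated_approximable sI).
- exact: open0.
- by move=> F oF; exact: bigcup_open.
- move=> A oA; exists (~` A)^°; first exact: open_interior.
  split.
    by apply/nowhere_dense_meager/nowhere_dense_frontier/open_closedC.
  by apply: (sigma_idealS sI) I0 => x [/interior_subset nAx /(_ nAx)].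
- move=> _ [x [y ->]]; exists `]x, y[%classic; first exact: interval_open.
  by rewrite setDv.
Qed.

(** By the Baire property [A] contains all of a ball but a meager set, and the
    translates of that meager set do not cover a smaller ball, by Baire's
    theorem. *)
Lemma steinhaus_meager (A : set R) :
  borel_mod (@meager R) A -> ~ meager A -> steinhaus A.
Proof.
have sI := meager_sigma_ideal => bA nA.
have I0 : @meager R set0 by exact: (sigma_ideal0 sI).
have [U oU [AU UA]] : approximable (@meager R) open A.
  move: A bA {nA}; apply: (generated_approximable sI).
  - exact: open0.
  - by move=> F oF; exact: bigcup_open.
  - move=> A oA; apply: borel_baire_property; apply: measurableC.
    exact: open_measurable.
  - move=> A [/borel_baire_property//|mA].
    by exists set0; [exact: open0|rewrite setD0 set0D].
have [c Uc] : U !=set0.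
  apply/set0P/eqP => U0; apply: nA.
  by move: AU; rewrite U0 setD0.
have [r/= r0 cU] : exists2 r, 0 < r & ball c r `<=` U.
  by have /nbhs_ballP[r r0 cU] := open_nbhs_nbhs (conj oU Uc); exists r.
apply: steinhaus_ball => n; exists c, r; split=> // s cov.
have mW : meager (\bigcup_i [set x | (U `\` A) (x + s i)]).
  by apply: (sigma_ideal_bigcup sI) => i; exact: meager_shift.
apply: (meager_no_ball (c := c) (r := r / 2) mW); first by rewrite divr_gt0.
by move=> x /cov[i _ [/cU Ux nAx]]; exists i.
Qed.

End category.

(** * Functions measurable modulo the ideal *)

Record steinhaus_ideal (R : realType) (I : set (set R)) : Prop :=
  SteinhausIdeal {
    steinhaus_ideal_sigma : sigma_ideal I;
    steinhaus_idealT : ~ I setT;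
    steinhaus_idealP : forall A, borel_mod I A -> ~ I A -> steinhaus A }.

Lemma null_or_meager_steinhaus_ideal (R : realType) (I : set (set R)) :
  I = @nullsets R \/ I = @meager R -> steinhaus_ideal I.
Proof.
move=> [] ->; split.
- exact: nullsets_sigma_ideal.
- move=> nT; have nb : lebesgue_measure.-negligible (ball (0 : R) 1).
    exact: negligibleS nT.
  have /eqP : lebesgue_measure (ball (0 : R) 1) = 0%E.
    by apply: measure_negligible nb; exact: measurable_ball.
  by rewrite lebesgue_measure_ball// eqe mulrn_eq0 oner_eq0.
- by move=> A; exact: steinhaus_nullsets.
- exact: meager_sigma_ideal.
- by move=> mT; apply: (meager_no_ball (c := 0) mT ltr01).
- by move=> A; exact: steinhaus_meager.
Qed.

Section modulo_ideal.
Context (R : realType) (I : set (set R)) (sI : steinhaus_ideal I).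

Let sigI := steinhaus_ideal_sigma sI.

Lemma borel_modI (A B : set R) : borel_mod I A -> borel_mod I B ->
  borel_mod I (A `&` B).
Proof.
move=> mA mB.
exact: (@measurableI _ (g_sigma_algebraType (measurable `|` I)) A B mA mB).
Qed.

(** The range of each [u i] is cut into countably many intervals of length [e];
    as the ideal is closed under countable unions, one of the pieces of [A]
    remains outside it. *)
Lemma almost_constant_subset (u : nat -> R -> R) (A : set R) (e : R) (n : nat) :
  0 < e -> (forall i, borel_mod_measurable I (u i)) ->
  borel_mod I A -> ~ I A ->
  exists B : set R, [/\ B `<=` A, borel_mod I B, ~ I B &
    forall i x y, (i < n)%N -> B x -> B y -> `|u i x - u i y| < e].
Proof.
move=> e0 mu; elim: n A => [|n IHn] A mA nA; first by exists A; split.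
have [B [BA mB nB Be]] := IHn A mA nA.
pose P (k : int) := u n @^-1` [set y | Num.floor (y / e) = k].
have mP k : borel_mod I (P k).
  apply: mu; rewrite (_ : [set y | _] = `[k%:~R * e, (k + 1)%:~R * e[%classic).
    exact: measurable_itv.
  apply/seteqP; split=> y /=; rewrite in_itv/= -ler_pdivlMr// -ltr_pdivrMr//.
    by move=> <-; exact: floor_itv.
  by move=> h; apply: floor_def.
have [k nBk] : exists k, ~ I (B `&` P k).
  apply: contrapT => nex; apply: nB.
  apply: (sigma_idealS sigI)
    (sigma_ideal_countable sigI (A := fun k => B `&` P k) _).
    by move=> x Bx; exists (Num.floor (u n x / e)).
  by move=> k; apply: contrapT => nI; apply: nex; exists k.
exists (B `&` P k); split=> //.
- by move=> x [/BA].
- exact: borel_modI.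
- move=> i x y; rewrite ltnS leq_eqVlt => /orP[/eqP ->|iltn] [Bx Px] [By Py].
    have := floor_itv (u n x / e); rewrite Px => /andP[x1 x2].
    have := floor_itv (u n y / e); rewrite Py => /andP[y1 y2].
    move: x1 x2 y1 y2; rewrite intrD !ler_pdivlMr// !ltr_pdivrMr// => x1 x2 y1 y2.
    by rewrite ltr_norml; nra.
  exact: Be.
Qed.

End modulo_ideal.

(** * The space of difference operators *)

Section difference_operators.
Context (R : realType).

(** Lists of pairs (coefficient, shift) give all difference operators a common
    parameter space, whatever their length. *)
Definition diffop (p : seq (R * R)) (f : R -> R) (x : R) : R :=
  \sum_(c <- p) c.1 * f (x + c.2).

Lemma difference_operatorP (D : (R -> R) -> R -> R) :
  difference_operator D -> exists p, D = diffop p.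
Proof.
move=> [n [a [b Dab]]]; exists [seq (a i, b i) | i <- enum 'I_n].
by apply/funext => f; apply/funext => x; rewrite Dab /diffop big_map big_enum.
Qed.

Lemma diffopB (p : seq (R * R)) (f g : R -> R) (x : R) :
  diffop p (fun y => -1 * g y + f y) x = diffop p f x - diffop p g x.
Proof.
rewrite /diffop -sumrB; apply: eq_bigr => c _; ring.
Qed.

Lemma diffop_subspace (F : set (R -> R)) (p : seq (R * R)) (f : R -> R) :
  translation_invariant F -> linear_subspace F -> F f -> F (diffop p f).
Proof.
move=> Ftr [F0 Flin] Ff; elim: p => [|c p IHp].
  rewrite (_ : diffop _ _ = fun=> 0)//.
  by apply/funext => x; rewrite /diffop big_nil.
rewrite (_ : diffop _ _ = fun x => c.1 * f (x + c.2) + diffop p f x).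
  by apply: Flin => //; exact: Ftr.
by apply/funext => x; rewrite /diffop big_cons.
Qed.

Definition close_coefficients (h : R) (p q : seq (R * R)) : Prop :=
  size q = size p /\ forall i, (i < size p)%N ->
    `|(nth 0 q i).1 - (nth 0 p i).1| < h /\ `|(nth 0 q i).2 - (nth 0 p i).2| < h.

(** The cells of a countable partition of the space of lists of coefficients;
    the mesh tends to [0] as [k] grows. *)
Definition grid (k : nat) (p : seq (R * R)) : seq (int * int) :=
  [seq (Num.floor (k.+1%:R * c.1), Num.floor (k.+1%:R * c.2)) | c <- p].

Lemma grid_close (k : nat) (p q : seq (R * R)) :
  grid k p = grid k q -> close_coefficients k.+1%:R^-1 p q.
Proof.
move=> pq; have spq : size q = size p by move/(congr1 size): pq; rewrite !size_map.
have floor_close (x y : R) :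
    Num.floor (k.+1%:R * x) = Num.floor (k.+1%:R * y) -> `|y - x| < k.+1%:R^-1.
  move=> xy; have := floor_itv (k.+1%:R * x); rewrite xy => /andP[x1 x2].
  have /andP[y1 y2] := floor_itv (k.+1%:R * y).
  have k0 : 0 < k.+1%:R :> R by [].
  rewrite -[ltRHS]mul1r ltr_pdivlMr// -[X in _ * X]gtr0_norm// -normrM.
  by move: x2 y2; rewrite intrD => x2 y2; rewrite ltr_norml; nra.
split=> // i ip; have : nth 0 (grid k p) i = nth 0 (grid k q) i by rewrite pq.
by rewrite !(nth_map 0) ?spq// => -[/floor_close ? /floor_close ?].
Qed.

End difference_operators.

(** * The upper bound *)

Section kernel_closed.
Context (R : realType) (I : set (set R)) (Ft : set (R -> R)).
Hypothesis sI : steinhaus_ideal I.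
Hypothesis Ft_meas : forall f, Ft f -> borel_mod_measurable I f.
Hypothesis Ft_trans : translation_invariant Ft.
Hypothesis Ft_lin : linear_subspace Ft.
Hypothesis Ft_ae0 : forall f, Ft f -> ae_for I (fun x => f x = 0) ->
  forall x, f x = 0.

Let sigI := steinhaus_ideal_sigma sI.

(** The set of operators annihilating [f] is closed in the space of coefficients
    and shifts.  If [diffop p f] were larger than [e] in absolute value on a set
    outside the ideal, shrink this set to [B] on which all the [f (x + b_i)] are
    nearly constant.  For [q] close to [p], the Steinhaus property for [B] gives
    an [x] at which the values entering [diffop q f x = 0] are close to those
    entering [diffop p f x0], for a fixed [x0] in [B]. *)
Lemma diffop_kernel_closed (f : R -> R) (p : seq (R * R)) : Ft f ->
  (forall h, 0 < h -> exists2 q, close_coefficients h p q &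
     forall x, diffop q f x = 0) ->
  forall x, diffop p f x = 0.
Proof.
move=> Ftf near0; apply: Ft_ae0; first exact: diffop_subspace.
apply: contrapT => nI.
pose A (k : nat) : set R := diffop p f @^-1` [set y | k.+1%:R^-1 < `|y|].
have [k nA] : exists k, ~ I (A k).
  apply: contrapT => nex; apply: nI.
  apply: (sigma_idealS sigI) (sigma_ideal_countable sigI (A := A) _).
    move=> x /= /eqP; rewrite -normr_gt0 => nx.
    have [k kx] := ltr_add_invr nx; exists k => //=.
    by rewrite add0r in kx.
  by move=> k; apply: contrapT => nA; apply: nex; exists k.
have mA : borel_mod I (A k).
  apply: Ft_meas; first exact: diffop_subspace.
  apply: open_measurable.
  rewrite -[X in open X]/((fun y : R => `|y|) @^-1` [set y | k.+1%:R^-1 < y]).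
  by apply: open_comp; [move=> *; exact: norm_continuous|exact: open_gt].
pose e : R := k.+1%:R^-1.
have e0 : 0 < e by rewrite invr_gt0.
pose n := size p.
pose S : R := \sum_(i < n) `|(nth 0 p i).1|.
have S0 : 0 <= S by apply: sumr_ge0.
(* [eta] bounds the variation of the values of [f], [h] that of the coefficients
   and shifts; each of them accounts for an error of at most [e / 2]. *)
pose eta : R := e / 2 / (S + 1).
have eta0 : 0 < eta by rewrite divr_gt0 ?divr_gt0// ltr_wpDl.
have [B [BA mB nB Beta]] := almost_constant_subset sI
  (u := fun i x => f (x + (nth 0 p i).2)) n eta0
  (fun i => Ft_meas (Ft_trans _ Ftf)) mA nA.
have [x0 Bx0] := sigma_ideal_nonempty sigI nB.
have [d d0 Bd] := steinhaus_idealP sI mB nB n.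
pose v i := f (x0 + (nth 0 p i).2).
pose V : R := \sum_(i < n) (`|v i| + eta).
have V0 : 0 <= V by apply: sumr_ge0 => i _; rewrite addr_ge0// ltW.
pose h := Num.min d (e / 2 / (V + 1)).
have h0 : 0 < h by rewrite lt_min d0 divr_gt0 ?divr_gt0// ltr_wpDl.
have [q [sq cpq] Dq] := near0 h h0.
have [x Bx] : exists x, forall i, (i < n)%N ->
    B (x + ((nth 0 q i).2 - (nth 0 p i).2)).
  by apply: Bd => i /cpq[_ /lt_le_trans]; apply; rewrite /h ge_min lexx.
pose w i := f (x + (nth 0 q i).2).
have vw i : (i < n)%N -> `|v i - w i| < eta.
  move=> iltn; have := Beta i _ _ iltn Bx0 (Bx i iltn).
  by rewrite -[x + _ + _]addrA subrK.
have := BA _ Bx0; rewrite /A/=; apply/negP; rewrite -leNgt.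
have -> : diffop p f x0 =
    \sum_(i < n) ((nth 0 p i).1 * v i - (nth 0 q i).1 * w i).
  have Ep : diffop p f x0 = \sum_(i < n) (nth 0 p i).1 * v i.
    by rewrite /diffop (big_nth 0) big_mkord.
  have Eq : diffop q f x = \sum_(i < n) (nth 0 q i).1 * w i.
    by rewrite /diffop (big_nth 0) big_mkord sq.
  by rewrite sumrB -Ep -Eq Dq subr0.
rewrite -/e.
apply: (le_trans (ler_norm_sum _ _ _)).
apply: (@le_trans _ _
  (\sum_(i < n) (`|(nth 0 p i).1| * eta + h * (`|v i| + eta)))).
  apply: ler_sum => i _.
  have [ci _] := cpq i (ltn_ord i); have vwi := vw i (ltn_ord i).
  have -> : (nth 0 p i).1 * v i - (nth 0 q i).1 * w i =
    (nth 0 p i).1 * (v i - w i) + - ((nth 0 q i).1 - (nth 0 p i).1) * w i by ring.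
  rewrite (le_trans (ler_normD _ _))// !normrM normrN; apply: lerD.
    by rewrite ler_wpM2l// ltW.
  apply: ler_pM => //; first exact: ltW.
  rewrite -[w i](subKr (v i)); apply: (le_trans (ler_normB _ _)).
  by rewrite lerD2l ltW.
rewrite big_split/= -mulr_suml -mulr_sumr -/S -/V.
have hV : h * V <= e / 2.
  apply: (@le_trans _ _ (e / 2 / (V + 1) * V)).
    by apply: ler_wpM2r => //; rewrite /h ge_min lexx orbT.
  by rewrite mulrAC ler_pdivrMr ?ltr_wpDl// ler_pM2l ?divr_gt0// lerDl.
have etaS : S * eta <= e / 2.
  by rewrite /eta mulrC mulrAC ler_pdivrMr ?ltr_wpDl// ler_pM2l ?divr_gt0// lerDl.
by rewrite [e]splitr lerD.
Qed.

End kernel_closed.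

(** A choice of one element of [E] in every nonempty cell of countably many
    countable partitions; it plays the role of hereditary separability. *)
Lemma countable_key_dense (X : Type) (T : countType) (key : nat -> X -> T)
    (E : set X) :
  exists C : set X, [/\ C `<=` E, countable C &
    forall j x, E x -> exists2 y, C y & key j y = key j x].
Proof.
have [->|/set0P[x0 Ex0]] := eqVneq E set0.
  by exists set0; split=> //; exact: countable0.
pose pick (t : nat * T) : X :=
  if pselect (exists y, E y /\ key t.1 y = t.2) is left e then projT1 (cid e)
  else x0.
exists (range pick); split.
- move=> _ [t _ <-]; rewrite /pick; case: pselect => [e|//].
  by case: (cid e) => y [].
- exact: sub_countable (card_image_le _ _) (countableP _).
- move=> j x Ex; exists (pick (j, key j x)); first by exists (j, key j x).
  rewrite /pick; case: pselect => [e|[]]; last by exists x.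
  by case: (cid e) => y [].
Qed.

Lemma card_lt_omega1 (T U : Type) (K : set T) (A : set U) : is_omega1 K ->
  card_lt A K <-> countable A.
Proof.
move=> [Kunc Kmin]; split=> [[_ nKA]|cA].
  by apply: contrapT => nA; exact/nKA/Kmin.
split; last by move=> KA; apply: Kunc; exact: sub_countable KA cA.
apply: card_le_trans cA _; apply/infiniteP => fK.
exact/Kunc/finite_set_countable.
Qed.

(** A solution of a countable subsystem with dense coefficients solves the whole
    system. *)
Lemma omega1_solvability (R : realType) (I : set (set R)) (F Ft : set (R -> R))
    (T : Type) (K : set T) :
  steinhaus_ideal I ->
  (forall f, Ft f -> borel_mod_measurable I f) ->
  F `<=` Ft -> translation_invariant Ft -> linear_subspace Ft ->
  (forall f, Ft f -> ae_for I (fun x => f x = 0) -> forall x, f x = 0) ->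
  is_omega1 K -> solvability_property F K.
Proof.
move=> sI Ft_meas FFt Ft_trans Ft_lin Ft_ae0 wK S dS sub.
have {}sub S' : S' `<=` S -> countable S' -> solvable_in F S'.
  by move=> S'S /(card_lt_omega1 _ wK); exact: sub.
have /choice[rep repP] (D : (R -> R) -> R -> R) :
    exists p, difference_operator D -> D = diffop p.
  have [dD|nD] := pselect (difference_operator D); last by exists [::].
  by have [p ->] := difference_operatorP dD; exists p.
have [C [CS cC Cdense]] := countable_key_dense (fun j s => grid j (rep s.1)) S.
have [f Ff fC] := sub C CS cC.
exists f => // D g SDg.
have [||f' Ff' f'C] := sub (C `|` [set (D, g)]).
- by move=> s [/CS|->].
- rewrite -bigcup2E; apply: bigcup_countable => // -[|[|k]] _ //=.
have DE := repP D (dS D g SDg).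
have <- : D f' = g by apply: f'C; right.
suff D0 x : diffop (rep D) (fun y => -1 * f y + f' y) x = 0.
  by rewrite DE; apply/funext => x; apply/esym/subr0_eq; rewrite -diffopB.
move: x; apply: (diffop_kernel_closed sI Ft_meas Ft_trans Ft_lin Ft_ae0).
  by apply: (Ft_lin.2); exact: FFt.
move=> h h0; have [k kh] := ltr_add_invr h0.
have [[D' g'] CD' /esym /grid_close[sz cl]] := Cdense k _ SDg.
exists (rep D').
  split=> // i ip; have [c1 c2] := cl i ip.
  by rewrite add0r in kh; split; exact: lt_trans kh.
have D'E := repP D' (dS D' g' (CS _ CD')).
have D'f : D' f = g' by exact: fC.
have D'f' : D' f' = g' by apply: f'C; left.
by move=> x; rewrite diffopB -D'E D'f D'f' subrr.
Qed.

(** * The lower bound *)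

Section lacunary.
Context (R : realType).

(** The amplitudes grow fast enough for each term to dominate the sum of the
    previous ones; the frequencies are powers of [4], so that a shift
    by the period of the next term moves the current one by a quarter of a
    period. *)
Definition lacunary (n : nat) (x : R) : R :=
  \sum_(k < n) 8 ^+ k * cos (2 * pi * 4 ^+ k * x).

Lemma lacunaryS (n : nat) (x : R) :
  lacunary n.+1 x = lacunary n x + 8 ^+ n * cos (2 * pi * 4 ^+ n * x).
Proof. by rewrite /lacunary big_ord_recr. Qed.

Lemma lacunary_trigonometric (n : nat) : trigonometric_polynomial (lacunary n).
Proof.
pose a (k : nat) : R := \sum_(j < n) if k == (4 ^ j)%N then 8 ^+ j else 0.
exists (4 ^ n)%N, a, (fun=> 0) => x.
rewrite {1}/a big1 ?add0r; last by move=> j _; rewrite ltn_eqF// expn_gt0.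
under eq_bigr do rewrite mul0r addr0 mulr_suml.
rewrite exchange_big/=; apply: eq_bigr => j _.
under eq_bigr do rewrite (fun_if (fun c => c * _)) mul0r.
by rewrite -big_mkcond/= big_nat1_eq expn_gt0/= ltnS leq_exp2l// ltnW// natrX.
Qed.

(** The geometric sum of the [8 ^ k] for [k < n] is [(8 ^ n - 1) / 7]. *)
Lemma lacunary_bound (n : nat) (x : R) : `|lacunary n x| <= 8 ^+ n / 7.
Proof.
elim: n => [|n IHn].
  by rewrite /lacunary big_ord0 normr0 divr_ge0.
rewrite lacunaryS (le_trans (ler_normD _ _))//.
have : `|8 ^+ n * cos (2 * pi * 4 ^+ n * x)| <= 8 ^+ n.
  rewrite normrM ger0_norm ?exprn_ge0// ler_piMr ?exprn_ge0//.
  by rewrite ler_norml cos_geN1 cos_le1.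
rewrite [8 ^+ n.+1]exprS; lra.
Qed.

Definition quarter_difference (n : nat) (f : R -> R) (x : R) : R :=
  f (x + 4 ^- n) - f x.

(** The terms of index at least [n] have period [4 ^- n]. *)
Lemma quarter_difference_lacunary (n m : nat) : (n <= m)%N ->
  quarter_difference n (lacunary m) = quarter_difference n (lacunary n).
Proof.
move=> /subnKC <-; apply/funext => x; elim: (m - n)%N => [|d IHd].
  by rewrite addn0.
rewrite addnS -{}IHd /quarter_difference !lacunaryS.
suff -> : 2 * pi * 4 ^+ (n + d) * (x + 4 ^- n) =
    2 * pi * 4 ^+ (n + d) * x + pi *+ 2 *+ (4 ^ d) :> R.
  rewrite (periodicn (@cosD2pi R)); ring.
rewrite exprD -[pi *+ 2 *+ _]mulr_natr natrX -mulr_natr.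
have : 4 ^+ n != 0 :> R by rewrite expf_neq0.
by move: (4 ^+ n : R) (4 ^+ d : R) => u v u0; field.
Qed.

Definition lacunary_system : set (((R -> R) -> (R -> R)) * (R -> R)) :=
  [set s | exists n,
    s = (quarter_difference n, quarter_difference n (lacunary n))].

Lemma lacunary_difference_system : difference_system lacunary_system.
Proof.
move=> _ _ [n [-> _]].
exists 2%N, (fun i => if i == ord0 then -1 else 1),
  (fun i => if i == ord0 then 0 else 4 ^- n) => f x.
by rewrite big_ord_recl big_ord1/= addr0 mulN1r mul1r addrC.
Qed.

Lemma lacunary_finite_subsystem S' : S' `<=` lacunary_system -> finite_set S' ->
  exists m, solution S' (lacunary m).
Proof.
move=> S'S fS'.
have /choice[ix ixP] s : exists n, S' s ->
    s = (quarter_difference n, quarter_difference n (lacunary n)).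
  have [/S'S[n ->]|nS'] := pselect (S' s); last by exists 0%N.
  by exists n.
have /finite_seqP[l ixl] := finite_image ix fS'.
exists (\max_(n <- l) n)%N => D g S'Dg.
have := ixP _ S'Dg; have := imageP ix S'Dg.
rewrite ixl; move: (ix (D, g)) => n nl [-> ->].
by apply: quarter_difference_lacunary; exact: leq_bigmax_seq.
Qed.

(** Along [x], [x + t], [x + 2 t], [x + 3 t] with [t = 4 ^- m.+1] a solution
    varies as [lacunary m.+1] does.  Comparing the first point with the third
    and the second with the fourth bounds both [8 ^+ m * cos] and [8 ^+ m * sin]
    at one angle by less than half of [8 ^+ m], which contradicts
    [cos ^ 2 + sin ^ 2 = 1]. *)
Lemma lacunary_unsolvable (I : set (set R)) (f : R -> R) :
  steinhaus_ideal I -> borel_mod_measurable I f -> ~ solution lacunary_system f.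
Proof.
move=> sI mf sol; have sigI := steinhaus_ideal_sigma sI.
have step n x : f (x + 4 ^- n) - f x = lacunary n (x + 4 ^- n) - lacunary n x.
  have /(congr1 (fun h => h x)) := sol _ _ (ex_intro _ n erefl); exact.
pose A (M : nat) := f @^-1` `[- M%:R, M%:R].
have [M nA] : exists M, ~ I (A M).
  apply: contrapT => nex; apply: (steinhaus_idealT sI).
  apply: (sigma_idealS sigI) (sigma_ideal_countable sigI (A := A) _); last first.
    by move=> M; apply: contrapT => nA; apply: nex; exists M.
  move=> x _; exists (Num.bound `|f x|) => //; rewrite /A/= in_itv/= -ler_norml.
  by rewrite ltW// archi_boundP.
have [d d0 Ad] := steinhaus_idealP sI (mf _ (measurable_itv _)) nA 4.
(* The first argument makes [8 ^+ m] exceed [4 * M], the second makes all four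
   points fall within reach of the Steinhaus property. *)
pose m := maxn (4 * M) (Num.bound (4 / d)).
have M8 : M%:R < 8 ^+ m / 4 :> R.
  rewrite ltr_pdivlMr// mulrC -natrM -natrX ltr_nat.
  by rewrite (leq_ltn_trans (leq_maxl _ (Num.bound (4 / d))))// ltn_expl.
have t4 : 4 * 4 ^- m.+1 < d :> R.
  rewrite ltr_pdivrMr ?exprn_gt0// mulrC -ltr_pdivrMr//.
  apply: (lt_trans (archi_boundP _)); first by rewrite divr_ge0// ltW.
  rewrite -natrX ltr_nat (leq_ltn_trans (leq_maxr (4 * M) _))// -/m.
  by rewrite (ltn_trans (ltnSn _))// ltn_expl.
set t : R := 4 ^- m.+1 in t4.
have t0 : 0 < t by rewrite invr_gt0 exprn_gt0.
have [x Ax] : exists x, forall i, (i < 4)%N -> A M (x + i%:R * t).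
  apply: Ad => i i4; rewrite ger0_norm ?mulr_ge0 ?(ltW t0)//.
  by rewrite (lt_trans _ t4)// ltr_pM2r// ltr_nat.
move: (Ax 0 isT) (Ax 1 isT) (Ax 2 isT) (Ax 3 isT).
rewrite /A/= !in_itv/= mul0r addr0 mul1r.
have := step m.+1 x; have := step m.+1 (x + t); have := step m.+1 (x + t + t).
rewrite -/t.
have -> : x + t + t + t = x + 3 * t by ring.
have -> : x + t + t = x + 2 * t by ring.
rewrite !lacunaryS.
have tE : 4 ^+ m * t = 4^-1.
  have : 4 ^+ m != 0 :> R by rewrite expf_neq0.
  by rewrite /t exprS; move: (4 ^+ m : R) => u u0; field.
set th := 2 * pi * 4 ^+ m * x.
have th1 : 2 * pi * 4 ^+ m * (x + t) = th + pi / 2.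
  by rewrite mulrDr -/th -mulrA [4 ^+ m * t]tE; field.
have th2 : 2 * pi * 4 ^+ m * (x + 2 * t) = th + pi.
  by rewrite mulrDr -/th -mulrA [4 ^+ m * _]mulrCA tE; field.
have th3 : 2 * pi * 4 ^+ m * (x + 3 * t) = th + pi / 2 + pi.
  by rewrite mulrDr -/th -mulrA [4 ^+ m * _]mulrCA tE; field.
rewrite th1 th2 th3 !cosDpi cosDpihalf.
move: (lacunary_bound m x) (lacunary_bound m (x + t))
  (lacunary_bound m (x + 2 * t)) (lacunary_bound m (x + 3 * t)).
have := cos2Dsin2 th.
have : 0 < 8 ^+ m :> R by rewrite exprn_gt0.
rewrite !ler_norml.
move: (8 ^+ m : R) (cos th) (sin th) M8 => u c s M8 u0 cs.
move=> /andP[? ?] /andP[? ?] /andP[? ?] /andP[? ?] e3 e2 e1.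
move=> /andP[? ?] /andP[? ?] /andP[? ?] /andP[? ?].
have : `|u * c| < u / 2 by rewrite ltr_norml; lra.
have : `|u * s| < u / 2 by rewrite ltr_norml; lra.
rewrite !ltr_norml => /andP[? ?] /andP[? ?].
have c2 : - (1 / 2) < c < 1 / 2 by nra.
have s2 : - (1 / 2) < s < 1 / 2 by nra.
by move: c2 s2 => /andP[? ?] /andP[? ?]; nra.
Qed.

(** For a countable [L] the subsystems of smaller cardinality are finite, and
    all of those of the lacunary system are solvable in [F]. *)
Lemma solvability_property_uncountable (I : set (set R)) (F : set (R -> R))
    (U : Type) (L : set U) :
  steinhaus_ideal I -> (forall f, F f -> borel_mod_measurable I f) ->
  (forall f, trigonometric_polynomial f -> F f) ->
  solvability_property F L -> ~ countable L.
Proof.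
move=> sI F_meas F_trig solv cL.
have [|f Ff solf] := solv _ lacunary_difference_system.
  move=> S' S'S [_ nLS'].
  have [|m solm] := lacunary_finite_subsystem S'S.
    apply: contrapT => /infiniteP NS'; apply: nLS'.
    exact: card_le_trans cL NS'.
  by exists (lacunary m) => //; exact/F_trig/lacunary_trigonometric.
exact: (lacunary_unsolvable sI (F_meas _ Ff) solf).
Qed.

End lacunary.

(** * The solvability cardinal *)

Lemma uncountable_real (R : realType) : ~ countable [set: R].
Proof.
move=> /countable_lebesgue_measure0 T0.
have : (lebesgue_measure (ball (0%R : R) 1%R) <= lebesgue_measure [set: R])%E.
  by apply: le_measure; rewrite ?inE//; exact: measurable_ball.
by rewrite [X in (_ <= X)%E]T0 lebesgue_measure_ball// lee_fin; lra.
Qed.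

Theorem corollary5p4 (R : realType) (I : set (set R)) (F Ft : set (R -> R))
    (hI : I = @nullsets R \/ I = @meager R)
    (F_meas : forall f, F f -> borel_mod_measurable I f)
    (Ft_meas : forall f, Ft f -> borel_mod_measurable I f)
    (F_trig : forall f, trigonometric_polynomial f -> F f)
    (F_sub : F `<=` Ft)
    (Ft_trans : translation_invariant Ft)
    (Ft_lin : linear_subspace Ft)
    (Ft_ae0 : forall f, Ft f -> ae_for I (fun x => f x = 0) ->
                forall x, f x = 0) :
  exists (T : Type) (K : set T), is_omega1 K /\ is_solvability_cardinal F K.
Proof.
have sI := null_or_meager_steinhaus_ideal hI.
have [K wK] := exists_omega1 (@uncountable_real R).
exists R, K; split=> //; split.
  exact: (omega1_solvability sI Ft_meas F_sub Ft_trans Ft_lin Ft_ae0 wK).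
move=> U L /(solvability_property_uncountable sI F_meas F_trig); exact: wK.2.
Qed.
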